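(* Let $n\geq 1$ be an integer and let $\mathfrak{A}_{2n}$ be any algorithm that, given any clutter $\mathcal{C}$ over a ground set of $2n$ elements via a filter oracle, decides whether or not $\mathcal{C}$ is ideal. Then in the worst case, $\mathfrak{A}_{2n}$ must make at least $2^n$ calls to the filter oracle.
   Context: A clutter over a finite ground set $V$ is a family $\mathcal{C}$ of subsets of $V$ (called members) such that no member contains another. $\mathcal{C}$ is ideal if the polyhedron $\{x\in\mathbb{R}^V:\sum_{u\in C}x_u\geq 1\ \forall C\in\mathcal{C};\ x\geq \mathbf{0}\}$ is integral (all its vertices are integral). A filter oracle for a clutter $\mathcal{C}$ consists of the ground set $V$ together with an oracle which, given any set $X\subseteq V$, decides in unit time whether or not $X$ contains a member of $\mathcal{C}$.
   Formalization: The theorem is proved for n ≥ 2 instead of n ≥ 1: for n = 1 every clutter over two elements is ideal, so the algorithm that always answers ''ideal'' is correct with no oracle calls and the claimed bound fails. *)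

(* Defs.v *)
From mathcomp Require Import all_boot all_order all_algebra.
From mathcomp Require Import reals.

Set Implicit Arguments.
Unset Strict Implicit.
Unset Printing Implicit Defensive.

Import Order.TTheory GRing.Theory Num.Theory.

Definition is_clutter (V : finType) (F : {set {set V}}) : Prop :=
  forall C D : {set V}, C \in F -> D \in F -> C \subset D -> C = D.

Section Ideal.
Local Open Scope ring_scope.
Variables (R : realType) (V : finType).
Implicit Types (F : {set {set V}}) (x y z : {ffun V -> R}).

Definition covering_polyhedron F x : Prop :=
  (forall C : {set V}, C \in F -> 1 <= \sum_(u in C) x u)
  /\ (forall u : V, 0 <= x u).

(* Vertices are taken to be the extreme points. *)
Definition is_vertex (P : {ffun V -> R} -> Prop) x : Prop :=
  P x /\
  forall y z (t : R), P y -> P z -> 0 < t < 1 ->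
    (forall u, x u = t * y u + (1 - t) * z u) -> y = x /\ z = x.

(* An empty polyhedron, as for F = [set set0], is integral. *)
Definition is_ideal F : Prop :=
  forall x, is_vertex (covering_polyhedron F) x ->
    forall u : V, x u \is a Num.int.

End Ideal.

Definition filter_oracle (V : finType) (F : {set {set V}}) (X : {set V}) : bool :=
  [exists C in F, C \subset X].

(* A deterministic oracle algorithm over the ground set V, seen as an adaptive
   decision tree: it either halts with a verdict, or calls the oracle on a set
   and goes on in a way that depends on the answer. Work between two calls is
   unrestricted and free. *)
Inductive algorithm (V : finType) : Type :=
  | Answer of bool
  | Call of {set V} & (bool -> algorithm V).

Fixpoint verdict (V : finType) (A : algorithm V) (oracle : {set V} -> bool)
    : bool :=
  match A with
  | Answer b => b
  | Call X next => verdict (next (oracle X)) oracle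
  end.

Fixpoint num_calls (V : finType) (A : algorithm V) (oracle : {set V} -> bool)
    : nat :=
  match A with
  | Answer _ => 0
  | Call X next => (num_calls (next (oracle X)) oracle).+1
  end.

Definition decides_idealness (R : realType) (V : finType) (A : algorithm V)
    : Prop :=
  forall F : {set {set V}}, is_clutter F ->
    (verdict A (filter_oracle F) <-> is_ideal R F).

(* Main.v *)
Require Import Defs.
From mathcomp Require Import all_boot all_order all_algebra.
From mathcomp Require Import reals.
From mathcomp Require Import fingroup perm lra zify.

Set Implicit Arguments.
Unset Strict Implicit.
Unset Printing Implicit Defensive.

Import Order.TTheory GRing.Theory Num.Theory.

(** Partition the ground set into n pairs {v, mate v}, and for every set S of
    transversals of this partition consider the clutter formed by the n pairs
    and the members of S. Its filter oracle is independent of S except on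
    transversals, where it tests membership in S.

    The number of S for which this clutter is ideal is odd. Indeed, swapping the
    two elements of one fixed pair {v, mate v} acts as an involution on the sets
    S and preserves idealness. If S is nonempty and fixed by it, then S contains
    two transversals differing only in that pair, and the clutter has a vertex
    with four coordinates equal to 1/2. If S is empty, the clutter is ideal.

    An adversary can therefore answer every call so that the number of ideal
    clutters consistent with the answers remains odd. When the algorithm halts,
    the consistent clutters are all ideal; as long as some transversal has not
    been queried, adding it to or removing it from S pairs them off, and their
    number is even. Hence all 2^n transversals have been queried. *)

(** * Parity under involutions and the adversary *)

(** The points moved by [f] fall into pairs [x], [f x]; the induction removes one such pair at a
    time. *)
Lemma odd_card_involution (T : finType) (f : T -> T) (E : {set T}) :
  involutive f -> (forall x, x \in E -> f x \in E) ->
  odd #|E| = odd #|[set x in E | f x == x]|.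
Proof.
move=> fK; have [m] := ubnP #|E|; elim: m E => // m IHm E ltEm fE.
have [x /andP[xE fx] | nofix] := pickP [pred x | (x \in E) && (f x != x)].
  pose E' := E :\ x :\ f x.
  have cE : #|E| = #|E'|.+2.
    by rewrite (cardsD1 x) xE (cardsD1 (f x) (E :\ x)) !inE fx fE.
  have fE' y : y \in E' -> f y \in E'.
    rewrite !inE => /and3P[yfx yx yE]; rewrite fE // andbT.
    by rewrite (inj_eq (inv_inj fK)) yx -[x in _ != x]fK (inj_eq (inv_inj fK)).
  rewrite cE /= negbK (IHm E') //; last by rewrite cE in ltEm; apply: ltnW.
  congr (odd #|pred_of_set _|); apply/setP=> y; rewrite !inE.
  have [->|_] := eqVneq y (f x).
    by rewrite fK [x == _]eq_sym (negbTE fx) !andbF.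
  by have [->|_] := eqVneq y x; rewrite /= ?(negbTE fx) ?andbF.
congr (odd #|pred_of_set _|); apply/setP=> x; rewrite !inE.
by have := nofix x; rewrite /=; case: (x \in E) => //= /negbFE ->.
Qed.

Definition toggle (T : finType) (x : T) (S : {set T}) : {set T} :=
  [set y | (y == x) (+) (y \in S)].

Lemma toggleK (T : finType) (x : T) : involutive (toggle x).
Proof. by move=> S; apply/setP=> y; rewrite !inE addbA addbb. Qed.

Lemma toggle_neq (T : finType) (x : T) (S : {set T}) : toggle x S != S.
Proof. by apply/eqP=> /setP/(_ x); rewrite inE eqxx; case: (x \in S). Qed.

(* [E] collects the hidden sets consistent with the answers given so far, and
   [U] the queries that have not been made. *)
Lemma adversary (V : finType) (o : {set {set V}} -> {set V} -> bool)
    (A : algorithm V) (U : {set {set V}}) (E : {set {set {set V}}}) :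
  (forall Y S, Y \in U -> S \in E -> toggle Y S \in E) ->
  (forall X Y S, Y \in U -> S \in E -> X != Y -> o (toggle Y S) X = o S X) ->
  odd #|[set S in E | verdict A (o S)]| ->
  exists2 S, S \in E & #|U| <= num_calls A (o S).
Proof.
elim: A U E => [b | X next IH] U E EU oU /= oddE.
  case: b oddE => oddE; last first.
    by move: oddE; rewrite (_ : [set _ in _ | _] = set0) ?cards0 //;
      apply/setP=> S; rewrite !inE andbF.
  have eE : [set S in E | true] = E by apply/setP=> S; rewrite !inE andbT.
  rewrite {}eE in oddE.
  (* If a query [Y] were left unmade, [toggle Y] would act on [E] without fixed points, making
     [#|E|] even. *)
  have [U0 | [Y YU]] := set_0Vmem U.
    have [E0 | [S SE]] := set_0Vmem E; first by rewrite E0 cards0 in oddE.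
    by exists S; rewrite // U0 cards0.
  move: oddE; rewrite (odd_card_involution (@toggleK _ Y)); last first.
    by move=> S; apply: EU.
  rewrite (_ : [set _ in _ | _] = set0) ?cards0 //.
  by apply/setP=> S; rewrite !inE (negbTE (toggle_neq _ _)) andbF.
pose Ec c := [set S in E | o S X == c].
(* The adversary's reply [c] to [X]: the two replies split the accepted sets, whose number is odd,
   so one part is odd. *)
have [c oddc] : exists c, odd #|[set S in Ec c | verdict (next c) (o S)]|.
  move: oddE; rewrite -(cardsID [set S | o S X]) oddD.
  set E1 := _ :&: _; set E0 := _ :\: _ => odd10.
  have e1 : E1 = [set S in Ec true | verdict (next true) (o S)].
    by apply/setP=> S; rewrite !inE; case: (o S X); rewrite ?andbT ?andbF.
  have e0 : E0 = [set S in Ec false | verdict (next false) (o S)].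
    by apply/setP=> S; rewrite !inE; case: (o S X); rewrite ?andbT ?andbF.
  rewrite {}e1 {}e0 in odd10.
  have [odd1|/negbTE even1] :=
    boolP (odd #|[set S in Ec true | verdict (next true) (o S)]|).
    by exists true.
  by exists false; rewrite even1 in odd10.
have UX Y : Y \in U :\ X -> Y \in U /\ X != Y.
  by rewrite !inE eq_sym => /andP[].
have EcP S : S \in Ec c -> S \in E /\ o S X = c.
  by rewrite inE => /andP[? /eqP].
(* Toggling [Y != X] keeps the answer at [X], so [Ec c] stays closed under the remaining toggles;
   one call uses up at most one element of [U]. *)
have [||S /EcP[SE SX] leS] := IH c (U :\ X) (Ec c) _ _ oddc.
- move=> Y S /UX[YU XY] /EcP[SE SX].
  by rewrite inE EU //= oU // SX.
- by move=> Z Y S /UX[YU _] /EcP[SE _]; apply: oU.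
exists S; rewrite // SX (cardsD1 X).
by case: (X \in U) => //; apply: ltnW.
Qed.

(** * Idealness under permutations of the ground set *)

Lemma reindex_preimset (R : realType) (V : finType) (s : {perm V})
    (C : {set V}) (x : V -> R) :
  (\sum_(u in s @^-1: C) x (s u) = \sum_(u in C) x u)%R.
Proof.
rewrite [RHS](reindex_inj (@perm_inj _ s)) /=.
by apply: eq_bigl => u; rewrite inE.
Qed.

(** Permuting coordinates is a linear bijection between the two polyhedra, so it carries vertices to
    vertices and keeps integrality. *)
Lemma is_ideal_perm (R : realType) (V : finType) (s : {perm V})
    (F G : {set {set V}}) :
  (forall C, (C \in G) = (s @^-1: C \in F)) -> is_ideal R F -> is_ideal R G.
Proof.
move=> GF idF x [[xG x0] xV] u.
pose p (y : {ffun V -> R}) : {ffun V -> R} := [ffun v => y (s v)].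
pose q (y : {ffun V -> R}) : {ffun V -> R} := [ffun v => y ((s^-1)%g v)].
have qcov y : covering_polyhedron F y -> covering_polyhedron G (q y).
  move=> [yF y0]; split=> [C | v]; last by rewrite ffunE.
  rewrite GF => /yF; rewrite -(reindex_preimset s C (q y)).
  by under [X in _ -> (_ <= X)%R]eq_bigr do rewrite ffunE permK.
have vp : is_vertex (covering_polyhedron F) (p x).
  split.
    split=> [C CF | v]; last by rewrite ffunE.
    have sC : s @^-1: (s @: C) = C.
      by apply/setP=> v; rewrite inE mem_imset //; apply: perm_inj.
    rewrite -sC; under eq_bigr do rewrite ffunE.
    by rewrite (reindex_preimset s (s @: C) x); apply: xG; rewrite GF sC.
  move=> y z t Fy Fz t01 xyz.
  have [|qy qz] := xV (q y) (q z) t (qcov _ Fy) (qcov _ Fz) t01.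
    by move=> v; rewrite !ffunE -xyz ffunE permKV.
  by split; apply/ffunP=> v; rewrite ffunE; [rewrite -qy | rewrite -qz];
    rewrite ffunE permK.
by have := idF _ vp ((s^-1)%g u); rewrite ffunE permKV.
Qed.

(** * Pairings and their transversals *)

Section Pairing.
Variables (V : finType) (mate : V -> V).
Hypotheses (mateK : involutive mate) (mate_neq : forall v, mate v != v).

Definition transversals : {set {set V}} :=
  [set T : {set V} | [forall v, (mate v \in T) == (v \notin T)]].

Definition mate_pairs : {set {set V}} := [set [set v; mate v] | v : V].

Lemma mate_pair_in v : [set v; mate v] \in mate_pairs.
Proof. exact: imset_f. Qed.

Lemma transversalP (T : {set V}) :
  reflect (forall v, (mate v \in T) = (v \notin T)) (T \in transversals).
Proof. by rewrite inE; apply: (iffP forallP) => + v => /(_ v)/eqP. Qed.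

Lemma pair_not_sub_transversal (T : {set V}) (v : V) :
  T \in transversals -> ~~ ([set v; mate v] \subset T).
Proof. by move/transversalP=> mT; rewrite subUset !sub1set mT andbN. Qed.

(** An element [v] of [X] outside [T] would have [mate v] in [T], so [X] would contain a pair. *)
Lemma transversal_maximal (T X : {set V}) :
  T \in transversals -> T \subset X ->
  (forall v, ~~ ([set v; mate v] \subset X)) -> T = X.
Proof.
move=> /transversalP mT TX nX; apply/eqP; rewrite eqEsubset TX /=.
apply/subsetP=> v vX; apply: contraR (nX v) => vT.
by rewrite subUset !sub1set vX (subsetP TX) // mT.
Qed.

Lemma filter_oracle_pairs (S : {set {set V}}) (X : {set V}) :
  S \subset transversals ->
  filter_oracle (mate_pairs :|: S) X
  = [exists v, [set v; mate v] \subset X] || (X \in S).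
Proof.
move=> SW; apply/existsP/orP=> [[C /andP[]] | [/existsP[v vX] | XS]].
- rewrite inE => /orP[/imsetP[v _ ->] vX | CS CX].
    by left; apply/existsP; exists v.
  have [/existsP|/existsPn nX] := boolP [exists v, [set v; mate v] \subset X].
    by move/existsP; left.
  by right; rewrite -(transversal_maximal (subsetP SW _ CS) CX nX).
- by exists [set v; mate v]; rewrite vX in_setU mate_pair_in.
- by exists X; rewrite inE XS orbT subxx.
Qed.

Lemma exists_outside_pair w : 2 < #|V| -> exists2 u, u != w & u != mate w.
Proof.
move=> V3; have /subsetPn[u _] : ~~ ([set: V] \subset [set w; mate w]).
  apply: contraL V3 => /subset_leq_card; rewrite cardsT -leqNgt => le2.
  by apply: leq_trans le2 _; rewrite cards2; case: (_ != _).
by rewrite !inE negb_or => /andP[]; exists u.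
Qed.

Lemma pairs_transversals_clutter (S : {set {set V}}) :
  2 < #|V| -> S \subset transversals -> is_clutter (mate_pairs :|: S).
Proof.
move=> V3 SW C D; rewrite !inE.
move=> /orP[/imsetP[v _ ->]|/(subsetP SW) CW]
       /orP[/imsetP[w _ ->]|/(subsetP SW) DW] CD.
- apply/eqP; rewrite eqEcard CD !cards2 ![_ == mate _]eq_sym.
  by rewrite !(negbTE (mate_neq _)).
- by case/negP: (pair_not_sub_transversal v DW).
(* A transversal inside the pair of [w] would miss both elements of another pair. *)
- have [u uw umw] := exists_outside_pair w V3.
  have notC x : x != w -> x != mate w -> x \notin C.
    move=> xw xmw; apply/negP=> /(subsetP CD).
    by rewrite !inE (negbTE xw) (negbTE xmw).
  have := notC _ uw umw; rewrite -(transversalP _ CW) => muC.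
  have := notC (mate u).
  rewrite muC (can2_eq mateK mateK) (inj_eq (inv_inj mateK)).
  by move=> /(_ umw uw).
- by apply: transversal_maximal => // v; apply: pair_not_sub_transversal.
Qed.

(** * Vertices of the covering polyhedra *)

Section Polyhedron.
Local Open Scope ring_scope.
Variable R : realType.
Implicit Types x y z : {ffun V -> R}.

Lemma sum_mate_pair (x : V -> R) v :
  \sum_(u in [set v; mate v]) x u = x v + x (mate v).
Proof. by rewrite big_setU1 ?big_set1 // inE eq_sym mate_neq. Qed.

Lemma mate_pairs_covering x :
  covering_polyhedron mate_pairs x <->
  (forall v, 1 <= x v + x (mate v)) /\ (forall v, 0 <= x v).
Proof.
split=> -[xF x0]; split=> //.
  by move=> v; rewrite -(sum_mate_pair x); apply/xF/mate_pair_in.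
by move=> _ /imsetP[v _ ->]; rewrite sum_mate_pair.
Qed.

(** Replacing the values of [x] on the pair of [u] by [a], [b] and by [a'], [b'] gives two covering
    points with midpoint [x]. Vertices can thus be tested one pair at a time. *)
Lemma vertex_pair_midpoint x u (a b a' b' : R) :
  is_vertex (covering_polyhedron mate_pairs) x ->
  0 <= a -> 0 <= b -> 0 <= a' -> 0 <= b' -> 1 <= a + b -> 1 <= a' + b' ->
  a + a' = 2 * x u -> b + b' = 2 * x (mate u) -> a = x u.
Proof.
move=> [/mate_pairs_covering[x1 x0] xV] a0 b0 a'0 b'0 ab ab' aa bb.
pose upd (c d : R) : {ffun V -> R} :=
  [ffun v => if v == u then c else if v == mate u then d else x v].
have updP c d : 0 <= c -> 0 <= d -> 1 <= c + d ->
    covering_polyhedron mate_pairs (upd c d).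
  move=> c0 d0 cd; apply/mate_pairs_covering; split=> v; rewrite !ffunE.
    rewrite (can2_eq mateK mateK) (inj_eq (inv_inj mateK)).
    have [->|vu] := eqVneq v u; first by rewrite eq_sym (negbTE (mate_neq _)).
    by have [_|vmu] := eqVneq v (mate u); rewrite // addrC.
  by do 2?case: ifP.
have [||e _] := xV _ _ 2^-1 (updP a b a0 b0 ab) (updP a' b' a'0 b'0 ab').
- by apply/andP; split; lra.
- move=> v; rewrite !ffunE; case: eqP => [->|_]; first by lra.
  by case: eqP => [->|_]; lra.
by move/ffunP/(_ u): e; rewrite ffunE eqxx.
Qed.

Lemma mate_pairs_ideal : is_ideal R mate_pairs.
Proof.
move=> x xV u; have [/mate_pairs_covering[x1 x0] _] := xV.
have [xu0 | xu0] := eqVneq (x u) 0; first by rewrite xu0 rpred0.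
have xu : 0 < x u by rewrite lt_def xu0 x0.
have x1u := x1 u; have xm := x0 (mate u).
have [m0 | m0] := eqVneq (x (mate u)) 0.
  have -> : x u = 1; last exact: rpred1.
  by apply/esym/(@vertex_pair_midpoint x u 1 0 (2 * x u - 1) 0 xV); lra.
have {m0}xm0 : 0 < x (mate u) by rewrite lt_def m0 x0.
(* With both values positive, the smaller one is either moved entirely onto the other or doubled at
   its expense; the sum of the pair is kept. *)
have [le | lt] := lerP (x u) (x (mate u)).
  have : 0 = x u; last by lra.
  by apply: (@vertex_pair_midpoint x u 0 (x u + x (mate u))
       (2 * x u) (x (mate u) - x u) xV); lra.
have : x u + x (mate u) = x u; last by lra.
by apply: (@vertex_pair_midpoint x u _ 0
     (x u - x (mate u)) (2 * x (mate u)) xV); lra.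
Qed.

Lemma half_not_int : (2^-1 : R) \isn't a Num.int.
Proof.
apply/negP=> /intrP[m em]; have : 2 * m%:~R = 1 :> R by lra.
rewrite -[2]/(2%:~R) -intrM => /eqP; rewrite -[1]/(1%:~R) eqr_int.
by case: m {em} => k; rewrite -[2]/(Posz 2) ?NegzE; lia.
Qed.

Lemma convex_comb_tight (t a b c : R) :
  0 < t < 1 -> c <= a -> c <= b -> t * a + (1 - t) * b = c -> a = c.
Proof.
move=> /andP[t0 t1] ca cb e.
have ta : 0 <= t * (a - c) by rewrite mulr_ge0 ?subr_ge0 // ltW.
have tb : 0 <= (1 - t) * (b - c) by rewrite mulr_ge0 ?subr_ge0 // ltW.
have /eqP : t * (a - c) = 0 by lra.
by rewrite mulf_eq0 gt_eqF //= subr_eq0 => /eqP.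
Qed.

(** A fractional vertex is exhibited: the constraints of the pairs, of [T] and of its neighbour, and
    nonnegativity on [T] outside [Q] are tight there and determine it. *)
Lemma adjacent_transversals_not_ideal (S : {set {set V}}) (T : {set V}) u v :
  S \subset transversals -> T \in S -> mate v |: (T :\ v) \in S ->
  v \in T -> u \in T -> u != v -> ~ is_ideal R (mate_pairs :|: S).
Proof.
move=> SW TS T'S vT uT uv idS.
have /transversalP mT := subsetP SW _ TS.
have mvT : mate v \notin T by rewrite mT negbK.
have muT : mate u \notin T by rewrite mT negbK.
have vmv : v != mate v by rewrite eq_sym.
pose Q := [set v; mate v; u; mate u].
have mateQ w : (mate w \in Q) = (w \in Q).
  rewrite !inE !(can2_eq mateK mateK) !mateK.
  by rewrite [(w == mate v) || _]orbC -!orbA [(w == mate u) || _]orbC.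
pose x : {ffun V -> R} := [ffun w => if w \in Q then 2^-1 else (w \notin T)%:R].
have xQ w : w \in Q -> x w = 2^-1 by rewrite ffunE => ->.
have xpair w : x w + x (mate w) = 1.
  by rewrite !ffunE mateQ mT; case: ifP => _; [|case: (w \in T)] => /=; lra.
have x_ge0 w : 0 <= x w.
  by rewrite ffunE; case: ifP => _; rewrite ?ler0n //; lra.
have sumT (y : V -> R) : (forall w, w \in T -> w \notin Q -> y w = 0) ->
    \sum_(w in T) y w = y v + y u
    /\ \sum_(w in mate v |: (T :\ v)) y w = y (mate v) + y u.
  move=> y0; have -> : \sum_(w in T) y w = y v + \sum_(w in T :\ v) y w.
    by rewrite (big_setD1 v).
  rewrite big_setU1 ?inE ?(negbTE mvT) ?andbF //=.
  rewrite (big_setD1 u) ?inE ?uv //= big1 ?addr0 // => w; rewrite !inE.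
  move=> /and3P[wu wv wT]; apply: y0; rewrite // !inE !negb_or wu wv !andbT /=.
  by apply/andP; split; apply: contraTneq wT => ->.
have x0 w : w \in T -> w \notin Q -> x w = 0.
  by move=> wT wQ; rewrite ffunE (negbTE wQ) wT.
have vQ : v \in Q by rewrite !inE eqxx.
have uQ : u \in Q by rewrite !inE eqxx !orbT.
have mvQ : mate v \in Q by rewrite mateQ.
have muQ : mate u \in Q by rewrite mateQ.
have xcov : covering_polyhedron (mate_pairs :|: S) x.
  split=> // C; rewrite inE => /orP[/imsetP[w _ ->]|CS].
    by rewrite sum_mate_pair xpair.
  (* A transversal takes one element from each of the two pairs in [Q], which already contributes
     1/2 + 1/2. *)
  have /transversalP mC := subsetP SW _ CS.
  have inC w : exists2 a, a \in C & a = w \/ a = mate w.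
    have [wC|wC] := boolP (w \in C); first by exists w => //; left.
    by exists (mate w); [rewrite mC | right].
  have [a aC aE] := inC v; have [b bC bE] := inC u.
  have ab : b != a.
    case: aE bE => -> [] ->; rewrite ?(inj_eq (inv_inj mateK)) //.
      by apply: contraNneq muT => ->.
    by apply: contraTneq uT => ->.
  have aQ : a \in Q by case: aE => ->.
  have bQ : b \in Q by case: bE => ->.
  rewrite (big_setD1 a) //= (big_setD1 b) ?inE ?ab //= !xQ //.
  have : 0 <= \sum_(w in C :\ a :\ b) x w by apply: sumr_ge0.
  by lra.
have x_unique y z (t : R) : covering_polyhedron (mate_pairs :|: S) y ->
    covering_polyhedron (mate_pairs :|: S) z -> 0 < t < 1 ->
    (forall w, x w = t * y w + (1 - t) * z w) -> y = x.
  move=> [yF y_ge0] [zF z_ge0] t01 xyz.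
  have tight C : C \in mate_pairs :|: S -> \sum_(w in C) x w = 1 ->
      \sum_(w in C) y w = 1.
    move=> CF Cx; apply: (convex_comb_tight t01 (yF _ CF) (zF _ CF)).
    rewrite -[RHS]Cx !mulr_sumr -big_split /=.
    by apply: eq_bigr => w _; rewrite xyz.
  have ypair w : y w + y (mate w) = 1.
    rewrite -(sum_mate_pair y); apply: tight; last by rewrite sum_mate_pair.
    by rewrite in_setU mate_pair_in.
  have y0 w : w \in T -> w \notin Q -> y w = 0.
    move=> wT wQ; apply: (convex_comb_tight t01 (y_ge0 w) (z_ge0 w)).
    by rewrite -xyz x0.
  have [xT xT'] := sumT x x0; have [yT yT'] := sumT y y0.
  (* Comparing [T] with its neighbour gives [y v = y (mate v)]; these sum to 1, so all four values
     on [Q] are 1/2. *)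
  have {}yT : y v + y u = 1.
    by rewrite -yT tight // ?inE ?TS ?orbT // xT !xQ //; lra.
  have {}yT' : y (mate v) + y u = 1.
    by rewrite -yT' tight // ?inE ?T'S ?orbT // xT' !xQ //; lra.
  have yv := ypair v; have yu := ypair u.
  apply/ffunP=> w; have [wQ|wQ] := boolP (w \in Q).
    rewrite xQ //; move: wQ; rewrite !inE -!orbA => /or4P[]/eqP-> ; lra.
  have [wT|wT] := boolP (w \in T); first by rewrite x0 ?y0.
  have := ypair w; have := xpair w.
  by rewrite (y0 (mate w)) ?(x0 (mate w)) ?mateQ ?mT // !addr0 => -> ->.
have xV : is_vertex (covering_polyhedron (mate_pairs :|: S)) x.
  split=> // y z t Py Pz t01 xyz; split; first exact: x_unique xyz.
  apply: (x_unique z y (1 - t)) => //.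
    by case/andP: t01 => *; apply/andP; split; lra.
  by move=> w; rewrite xyz; lra.
by have := idS x xV v; rewrite xQ // (negbTE half_not_int).
Qed.

End Polyhedron.

(** * Swapping the two elements of one pair *)

Lemma tperm_mate v w : mate (tperm v (mate v) w) = tperm v (mate v) (mate w).
Proof.
have [->|wv] := eqVneq w v; first by rewrite tpermL tpermR mateK.
have [->|wmv] := eqVneq w (mate v); first by rewrite tpermR mateK tpermL.
by rewrite !tpermD // eq_sym ?(inj_eq (inv_inj mateK)) // (can2_eq mateK mateK).
Qed.

Lemma preim_tpermK (v w : V) :
  involutive (fun C : {set V} => tperm v w @^-1: C).
Proof. by move=> C; apply/setP=> u; rewrite !inE tpermK. Qed.

Lemma preim_tperm_transversal v (T : {set V}) :
  (tperm v (mate v) @^-1: T \in transversals) = (T \in transversals).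
Proof.
have impl (U : {set V}) : U \in transversals ->
    tperm v (mate v) @^-1: U \in transversals.
  move=> /transversalP mU; apply/transversalP=> w.
  by rewrite !inE -tperm_mate mU.
by apply/idP/idP=> /impl //; rewrite preim_tpermK.
Qed.

Lemma preim_tperm_pair v (C : {set V}) :
  C \in mate_pairs -> tperm v (mate v) @^-1: C \in mate_pairs.
Proof.
move=> /imsetP[w _ ->]; apply/imsetP; exists (tperm v (mate v) w) => //.
apply/setP=> u; rewrite !inE tperm_mate.
by rewrite !(can2_eq (tpermK _ _) (tpermK _ _)).
Qed.

Lemma preim_tperm_adjacent v (T : {set V}) :
  T \in transversals -> v \in T ->
  tperm v (mate v) @^-1: T = mate v |: (T :\ v).
Proof.
move=> /transversalP mT vT; apply/setP=> w; rewrite !inE.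
case: tpermP => [->|->|/eqP wv /eqP wmv].
- by rewrite mT vT eqxx eq_sym (negbTE (mate_neq _)).
- by rewrite vT eqxx.
- by rewrite (negbTE wv) (negbTE wmv).
Qed.

Definition swap_family (v : V) (S : {set {set V}}) : {set {set V}} :=
  [set C : {set V} | tperm v (mate v) @^-1: C \in S].

Lemma swap_familyK v : involutive (swap_family v).
Proof.
by move=> S; apply/setP=> C; rewrite !inE preim_tpermK.
Qed.

Lemma swap_family_sub v (S : {set {set V}}) :
  S \subset transversals -> swap_family v S \subset transversals.
Proof.
move=> SW; apply/subsetP=> C; rewrite inE => /(subsetP SW).
by rewrite preim_tperm_transversal.
Qed.

Lemma swap_family_ideal (R : realType) v (S : {set {set V}}) :
  is_ideal R (mate_pairs :|: S) -> is_ideal R (mate_pairs :|: swap_family v S).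
Proof.
apply: (is_ideal_perm (s := tperm v (mate v))) => C; rewrite !in_setU inE.
congr (_ || _); apply/idP/idP=> [|/(preim_tperm_pair v)].
  exact: preim_tperm_pair.
by rewrite preim_tpermK.
Qed.

Lemma swap_fixed_ideal (R : realType) v (S : {set {set V}}) :
  2 < #|V| -> S \subset transversals -> swap_family v S = S ->
  is_ideal R (mate_pairs :|: S) -> S = set0.
Proof.
move=> V3 SW fixS idS; apply/eqP/negP=> /negP/set0Pn[T TS].
have TW := subsetP SW _ TS; have /transversalP mT := TW.
have T'S : tperm v (mate v) @^-1: T \in S.
  by rewrite -fixS !inE in TS.
(* [w] is the element of the pair of [v] that lies in [T]. *)
have [w wT T'E] : exists2 w, w \in T
    & tperm v (mate v) @^-1: T = mate w |: (T :\ w).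
  have [vT|vT] := boolP (v \in T).
    by exists v; rewrite // preim_tperm_adjacent.
  have mvT : mate v \in T by rewrite mT.
  exists (mate v); rewrite // -preim_tperm_adjacent // mateK.
  by rewrite tpermC.
rewrite {}T'E in T'S.
have [u uw umw] := exists_outside_pair w V3.
(* The second pair needed for the half-integral vertex meets [T] in [u] or in [mate u]. *)
have [uT|uT] := boolP (u \in T).
  exact: (adjacent_transversals_not_ideal SW TS T'S wT uT uw idS).
apply: (@adjacent_transversals_not_ideal R S T (mate u) w) => //.
  by rewrite mT.
by rewrite (can2_eq mateK mateK).
Qed.

End Pairing.

(** * Counting transversals and the lower bound *)

(** [V] is identified with ['I_n * bool] and [mate] flips the boolean. Each subset [J] of ['I_n]
    gives its own transversal, taking from pair [i] the element with boolean [i \in J]. *)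
Lemma exists_pairing (V : finType) n : #|V| = 2 * n ->
  exists mate : V -> V, [/\ involutive mate, forall v, mate v != v
    & 2 ^ n <= #|transversals mate|].
Proof.
move=> cV; have cE : #|V| = #|{: 'I_n * bool}|.
  by rewrite card_prod card_ord card_bool mulnC.
pose h (v : V) : 'I_n * bool := enum_val (cast_ord cE (enum_rank v)).
pose g (p : 'I_n * bool) : V := enum_val (cast_ord (esym cE) (enum_rank p)).
have hK : cancel h g by move=> v; rewrite /g /h enum_valK cast_ordK enum_rankK.
have gK : cancel g h by move=> p; rewrite /g /h enum_valK cast_ordKV enum_rankK.
pose mate v := g ((h v).1, ~~ (h v).2).
have hm v : h (mate v) = ((h v).1, ~~ (h v).2) by rewrite gK.
exists mate; split.
- by move=> v; rewrite {1}/mate hm /= negbK -surjective_pairing hK.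
- move=> v; apply/eqP=> /(congr1 h); rewrite hm; case: (h v) => i b [].
  by case: b.
pose tr (J : {set 'I_n}) := [set v | (h v).2 == ((h v).1 \in J)].
have tr_inj : injective tr.
  move=> J K /setP e; apply/setP=> i; have := e (g (i, true)).
  by rewrite !inE gK /= ![true == _]eq_sym !eqb_id.
have -> : 2 ^ n = #|[set tr J | J : {set 'I_n}]|.
  by rewrite card_imset // -cardsT -powersetT card_powerset cardsT card_ord.
apply: subset_leq_card; apply/subsetP=> _ /imsetP[J _ ->].
rewrite inE; apply/forallP=> v; rewrite !inE hm /=.
by case: (h v).2; case: (_ \in J).
Qed.

(* The bound fails for n = 1: every clutter over two elements is ideal, so the
   algorithm that always answers yes is correct and makes no call. *)
Theorem theorem1 (R : realType) (n : nat) (V : finType) (A : algorithm V) :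
  2 <= n -> #|V| = 2 * n -> decides_idealness R A ->
  exists F : {set {set V}},
    is_clutter F /\ 2 ^ n <= num_calls A (filter_oracle F).
Proof.
move=> n2 cV decA; have V3 : 2 < #|V|.
  by rewrite cV; apply: leq_trans (_ : 2 * 2 <= _); rewrite ?leq_mul2l.
have [mate [mateK mate_neq cW]] := exists_pairing cV.
have /card_gt0P[v _] : 0 < #|V| by apply: leq_trans V3.
pose W := transversals mate.
pose F (S : {set {set V}}) := mate_pairs mate :|: S.
have clF (S : {set {set V}}) : S \subset W -> is_clutter (F S).
  exact: pairs_transversals_clutter.
have toggleW Y (S : {set {set V}}) :
    Y \in W -> S \in powerset W -> toggle Y S \in powerset W.
  rewrite !powersetE => YW SW; apply/subsetP=> C; rewrite inE.
  by case: eqP => [->|_ /(subsetP SW)].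
(* Initially every family of transversals is consistent and every transversal is an unmade query. *)
have [||S] :=
  @adversary V (fun S => filter_oracle (F S)) A W (powerset W) toggleW.
- move=> X Y S YW SW XY; have tW := toggleW _ _ YW SW.
  rewrite !powersetE in SW tW.
  by rewrite !filter_oracle_pairs // !inE (negbTE XY).
(* Among the accepted families only [set0] is fixed by the swap, so their number is odd. *)
- rewrite (odd_card_involution (swap_familyK mate v)) => [|S].
    rewrite (_ : [set _ in _ | _] = [set set0]) ?cards1 //.
    apply/setP=> S; rewrite !inE; apply/idP/eqP=> [|->].
      move=> /andP[/andP[SW vS] /eqP fixS].
      apply: (swap_fixed_ideal (R := R) mateK mate_neq V3 SW fixS).
      exact/(decA _ (clF _ SW)).
    rewrite sub0set /=; apply/andP; split.
      apply/(decA _ (clF _ (sub0set _))); rewrite /F setU0.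
      exact: mate_pairs_ideal.
    by apply/eqP/setP=> C; rewrite !inE.
  rewrite !inE => /andP[SW /(decA _ (clF _ SW)) idS].
  have SW' := swap_family_sub mateK v SW.
  rewrite SW' /=; apply/(decA _ (clF _ SW')).
  exact: swap_family_ideal.
rewrite powersetE => SW leS.
by exists (F S); split; [apply: clF | apply: leq_trans leS].
Qed.
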